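(* Let $n\geq 1$ and $\ell\geq 0$ be integers, and let $\mathcal{P}(\ell)=(f_1,\dots,f_{k})$ be a path of $k=n-\lceil n/2\rceil+\ell$ faces. Consider the path configuration $R(\ell)=(n,\dots,n,0,\dots,0)$ on $\mathcal{P}(\ell)$, consisting of $\ell$ entries equal to $n$ followed by $n-\lceil n/2\rceil$ entries equal to $0$. Then path-firing on $R(\ell)$ terminates uniquely: every sequence of path fires starting at $R(\ell)$ is finite and all maximal sequences end at the same path-stable configuration.
   Context: A path is a sequence of faces $(f_1,\dots,f_k)$ of the square grid with consecutive faces adjacent (sharing an edge). A path configuration $R$ assigns an integer weight $R_i$ to each $f_i$. A path fire is a move involving only consecutive faces of the path: if $R_i\geq R_{i+1}+2$ one may replace $(R_i,R_{i+1})$ by $(R_i-1,R_{i+1}+1)$, and if $R_{i+1}\geq R_i+2$ one may replace $(R_i,R_{i+1})$ by $(R_i+1,R_{i+1}-1)$. A path configuration is path-stable if no path fire is possible. *)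

(* Defs.v *)
From mathcomp Require Import all_boot all_order all_algebra.

Set Implicit Arguments.
Unset Strict Implicit.
Unset Printing Implicit Defensive.

Import Order.TTheory GRing.Theory Num.Theory.
Local Open Scope ring_scope.

(* The face (x, y) is the unit square [x, x + 1] * [y, y + 1] of the grid on
   Z^2. *)
Definition face : Type := (int * int)%type.

(* (true, v) is the horizontal grid edge from v to v + (1, 0), and (false, v)
   is the vertical grid edge from v to v + (0, 1). *)
Definition grid_edge : Type := (bool * (int * int))%type.

Definition edges_of (f : face) : seq grid_edge :=
  [:: (true, (f.1, f.2)); (true, (f.1, f.2 + 1));
      (false, (f.1, f.2)); (false, (f.1 + 1, f.2))].

Definition adjacent (f g : face) : bool :=
  (f != g) && has (mem (edges_of f)) (edges_of g).

(* The faces of a path are not required to be distinct; accordingly weights are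
   attached to the positions along the path. *)
Definition face_path (P : seq face) : bool := sorted adjacent P.

Definition path_config (P : seq face) : Type := {ffun 'I_(size P) -> int}.

Definition move_unit (P : seq face) (a b : 'I_(size P)) (R : path_config P) :
    path_config P :=
  [ffun i => if i == a then R i - 1 else if i == b then R i + 1 else R i].

Definition path_fire (P : seq face) : rel (path_config P) :=
  fun R R' => [exists i : 'I_(size P), exists j : 'I_(size P),
    (j == i.+1 :> nat) &&
    (((R i >= R j + 2) && (R' == move_unit i j R)) ||
     ((R j >= R i + 2) && (R' == move_unit j i R)))].

Definition path_stable (P : seq face) (R : path_config P) : Prop :=
  forall R' : path_config P, ~~ path_fire R R'.

Definition infinite_firing (P : seq face) (R : path_config P)
    (s : nat -> path_config P) : Prop :=
  s 0%N = R /\ forall m : nat, path_fire (s m) (s m.+1).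

(* s lists the configurations reached after R, so that last R s is the final
   one. *)
Definition finite_firing (P : seq face) (R : path_config P)
    (s : seq (path_config P)) : bool :=
  path (@path_fire P) R s.

Definition maximal_firing (P : seq face) (R : path_config P)
    (s : seq (path_config P)) : Prop :=
  finite_firing R s /\
  forall R' : path_config P, ~~ finite_firing R (rcons s R').

Definition R_init (n l : nat) (P : seq face) : path_config P :=
  [ffun i : 'I_(size P) => if (i < l)%N then n%:Z else 0].

(* Main.v *)
(* Firing preserves weakly decreasing configurations.  On those only downward
   fires R_i -> R_(i+1) occur, and in terms of the differences
   d_i = R_i - R_(i+1) >= 0 they are chip-firing on a line: d_i drops by 2 and
   its neighbours gain 1.  Firing one site never disables another, so distinct
   fires commute, which together with termination (the sum of the squares of
   the weights decreases) gives a unique final configuration. *)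
Require Import Defs.
From mathcomp Require Import all_boot all_order all_algebra.
From mathcomp Require Import zify ring.

Import Order.TTheory GRing.Theory Num.Theory.

Section Termination.
Variables (T : Type) (e : rel T) (mu : T -> nat).
Hypothesis mu_dec : forall x y, e x y -> mu y < mu x.

Lemma measure_no_infinite_chain (s : nat -> T) : ~ (forall m, e (s m) (s m.+1)).
Proof.
move=> es.
have bound m : mu (s m) + m <= mu (s 0).
  elim: m => [|m IHm]; first by rewrite addn0.
  by have := mu_dec _ _ (es m); lia.
by have := bound (mu (s 0)).+1; lia.
Qed.

(** The diamond below is only asked on states satisfying [inv]: for path firing it fails in general,
    as (0,2,0) fires to the two distinct stable configurations (1,1,0) and (0,1,1). *)
Variable inv : T -> Prop.
Hypothesis inv_step : forall x y, inv x -> e x y -> inv y.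
Hypothesis step_dec : forall x, (exists y, e x y) \/ (forall y, ~~ e x y).
Hypothesis diamond : forall x y z, inv x -> e x y -> e x z ->
  y = z \/ exists2 w, e y w & e z w.

(** Newman-style strong induction on [mu x]. The reachability clause lets the common successor of
    two steps be continued to a normal form. *)
Lemma diamond_unique_normal_form (x : T) : inv x ->
  exists S, [/\ forall y, ~~ e S y,
                exists2 s, path e x s & last x s = S
              & forall s, path e x s -> (forall y, ~~ e (last x s) y) ->
                  last x s = S].
Proof.
have [n] := ubnP (mu x); elim: n => // n IHn in x *.
rewrite ltnS => mux Ix.
have IH y : e x y -> exists S, [/\ forall y, ~~ e S y,
                exists2 s, path e y s & last y s = S
              & forall s, path e y s -> (forall z, ~~ e (last y s) z) ->
                  last y s = S].
  move=> exy; apply: IHn; last exact: inv_step Ix exy.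
  exact: leq_trans (mu_dec _ _ exy) mux.
have [[y exy]|xnf] := step_dec x; last first.
  exists x; split=> //; first by exists [::].
  by case=> [|y s] //= /andP[exy _]; have := xnf y; rewrite exy.
have [S [Snf [s ps sS] uniqS]] := IH y exy.
exists S; split=> //; first by exists (y :: s); rewrite /= ?exy.
case=> [_ xnf|z t /= /andP[exz pt] tnf]; first by have := xnf y; rewrite /= exy.
case: (diamond _ _ _ Ix exy exz) => [yz|[w eyw ezw]].
  by subst z; exact: uniqS.
have Iy := inv_step _ _ Ix exy.
have [|U [Unf [u pu uU] _]] := IHn w _ (inv_step _ _ Iy eyw).
  exact: leq_trans (mu_dec _ _ eyw) (leq_trans (ltnW (mu_dec _ _ exy)) mux).
have [V [_ _ uniqV]] := IH z exz.
(* [U] is a normal form reached through [w] from both [y] and [z], so uniqueness at [y] and at [z]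
   forces [S = U = V]. *)
have US : U = S.
  by rewrite -uU; apply: (uniqS (w :: u)); rewrite /= ?eyw ?uU.
have UV : U = V.
  by rewrite -uU; apply: (uniqV (w :: u)); rewrite /= ?ezw ?uU.
by rewrite -US UV; exact: uniqV.
Qed.

End Termination.

Section PathFiring.
Local Open Scope ring_scope.
Variable P : seq face.
Implicit Types (R : path_config P) (i j : 'I_(size P)).

Lemma path_fireP R R' :
  reflect (exists i j, (j == i.+1 :> nat) /\
             (R j + 2 <= R i /\ R' = move_unit i j R \/
              R i + 2 <= R j /\ R' = move_unit j i R))
          (path_fire R R').
Proof.
apply: (iffP existsP) => [[i /existsP[j /andP[ij /orP[]/andP[le /eqP->]]]]|].
- by exists i, j; split; [|left].
- by exists i, j; split; [|right].
case=> i [j [ij fire]]; exists i; apply/existsP; exists j; rewrite ij /=.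
by case: fire => -[-> ->]; rewrite eqxx ?orbT.
Qed.

(** Configurations form an infinite type, but every result of a fire is a unit move between two
    positions, so a search over finitely many pairs decides. *)
Lemma path_fire_dec R :
  (exists R', path_fire R R') \/ (forall R', ~~ path_fire R R').
Proof.
pose fires (p : 'I_(size P) * 'I_(size P)) :=
  path_fire R (move_unit p.1 p.2 R).
case: (pickP fires) => [p fire|nofire]; first by left; exists (move_unit p.1 p.2 R).
right=> R'; apply/negP => fire.
have /path_fireP[i [j [_ []]]] := fire => -[_ E].
  by have := nofire (i, j); rewrite /fires /= -E fire.
by have := nofire (j, i); rewrite /fires /= -E fire.
Qed.

Definition energy R : nat := `|\sum_i R i ^+ 2|.

(** Only two squares change, and the sum changes by [2 * (R j - R i + 1)], which is at most -2. *)
Lemma energy_move_unit R i j : R j + 2 <= R i -> (energy (move_unit i j R) < energy R)%N.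
Proof.
move=> le.
have ji : j != i by apply: contraTneq le => ->; lia.
have sum_ge0 R' : 0 <= \sum_k R' k ^+ 2 :> int.
  by apply: sumr_ge0 => k _; exact: sqr_ge0.
rewrite /energy -ltz_nat !gez0_abs //.
rewrite (bigD1 i) //= (bigD1 j) //= [ltRHS](bigD1 i) //= [X in _ < _ + X](bigD1 j) //=.
rewrite (eq_bigr (fun k => R k ^+ 2)); last first.
  by move=> k /andP[/negbTE ki /negbTE kj]; rewrite ffunE ki kj.
rewrite !ffunE !eqxx (negbTE ji) !addrA ltrD2r.
nia.
Qed.

Lemma energy_path_fire R R' : path_fire R R' -> (energy R' < energy R)%N.
Proof.
by case/path_fireP=> i [j [_ []]] [le ->]; exact: energy_move_unit.
Qed.

Definition decreasing R := forall i j, j = i.+1 :> nat -> R j <= R i.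

Lemma path_fire_decreasing R R' : decreasing R -> path_fire R R' ->
  exists i j, [/\ j = i.+1 :> nat, R j + 2 <= R i & R' = move_unit i j R].
Proof.
move=> decR /path_fireP[i [j [/eqP ij [[le E]|[le _]]]]]; first by exists i, j.
by have := decR i j ij; lia.
Qed.

(** The indicator form makes moves additive, hence visibly commuting. At [i = j] it would fail,
    since [move_unit] tests its source first. *)
Lemma move_unitE R i j k : i != j ->
  move_unit i j R k = R k - (k == i)%:R + (k == j)%:R.
Proof.
move=> ij; rewrite ffunE; case: eqVneq => [->|_].
  by rewrite (negbTE ij) addr0.
by case: eqP; rewrite subr0 ?addr0.
Qed.

Lemma succ_ord_neq i j : j = i.+1 :> nat -> i != j.
Proof. by move=> ij; rewrite -val_eqE /= ij; lia. Qed.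

Lemma decreasing_path_fire R R' :
  decreasing R -> path_fire R R' -> decreasing R'.
Proof.
move=> decR /(path_fire_decreasing _ _ decR)[i [j [ij le ->]]] a b ab.
have := decR a b ab; rewrite !move_unitE ?succ_ord_neq //.
(* The fired gap loses 2 and was at least 2. In any other pair, [a] is not the source and [b] not
   the target, so the gap cannot shrink. *)
case: (eqVneq a i) => [ai|ai].
  have -> : b = j by apply: val_inj; rewrite /= ab ij ai.
  rewrite ai !eqxx [j == i]eq_sym (negbTE (succ_ord_neq _ _ ij)).
  by lia.
have bj : b == j = false.
  apply: contraNF ai => /eqP bj; apply/eqP/val_inj => /=.
  by move: ab; rewrite bj ij; lia.
by rewrite bj; case: (b == i); case: (a == j); lia.
Qed.

Lemma path_fire_diamond R R1 R2 :
  decreasing R -> path_fire R R1 -> path_fire R R2 ->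
  R1 = R2 \/ exists2 R', path_fire R1 R' & path_fire R2 R'.
Proof.
move=> decR /(path_fire_decreasing _ _ decR)[i [i' [ii' lei ->]]].
move=> /(path_fire_decreasing _ _ decR)[j [j' [jj' lej ->]]].
have [ni nj] := (succ_ord_neq _ _ ii', succ_ord_neq _ _ jj').
have [ij|ij] := eqVneq i j.
  have -> : i' = j' by apply: val_inj; rewrite /= ii' jj' ij.
  by left; rewrite ij.
have ij' : i' != j'.
  by apply: contraNneq ij => E; apply/eqP/val_inj => /=; move: ii'; rewrite E jj'; lia.
have commute : move_unit j j' (move_unit i i' R) = move_unit i i' (move_unit j j' R).
  by apply/ffunP => k; rewrite !move_unitE //; ring.
right; exists (move_unit j j' (move_unit i i' R)); apply/path_fireP.
- exists j, j'; split; [exact/eqP|left; split=> //].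
  (* As sources and targets differ, the first fire can only raise the weight at [j] and lower that
     at [j']; the second fire stays legal. *)
  rewrite !move_unitE // [j == i]eq_sym [j' == i']eq_sym (negbTE ij) (negbTE ij').
  by case: (j' == i); case: (j == i'); lia.
- exists i, i'; split; [exact/eqP|left; split=> //].
  rewrite !move_unitE // (negbTE ij) (negbTE ij').
  by case: (i' == j); case: (i == j'); lia.
Qed.

Lemma maximal_firing_stable R s : maximal_firing R s -> path_stable (last R s).
Proof.
case=> fs maxs R'; have := maxs R'.
by rewrite /finite_firing rcons_path (fs : path _ _ _).
Qed.

Lemma decreasing_R_init n l : decreasing (R_init n l P).
Proof.
by move=> i j ij; rewrite !ffunE ij; case: ltnP => ?; case: ltnP => ?; lia.
Qed.

End PathFiring.

(* uphalf n is the ceiling of n / 2 *)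
Theorem theorem3p5 (n l : nat) (P : seq face) :
  1 <= n ->
  face_path P ->
  size P = n - uphalf n + l ->
  (forall s : nat -> path_config P, ~ infinite_firing (R_init n l P) s) /\
  (exists S : path_config P,
     path_stable S /\
     forall s : seq (path_config P),
       maximal_firing (R_init n l P) s -> last (R_init n l P) s = S).
Proof.
move=> _ _ _; split.
  move=> s [_]; exact: (measure_no_infinite_chain _ _ _ (@energy_path_fire P)).
have [S [Snf _ uniqS]] := diamond_unique_normal_form _ _ _
  (@energy_path_fire P) _ (@decreasing_path_fire P) (@path_fire_dec P)
  (@path_fire_diamond P) _ (decreasing_R_init P n l).
exists S; split=> // s maxs.
apply: uniqS; first by case: maxs.
exact: maximal_firing_stable.
Qed.
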